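(* Let $(R,\tau)$ be a topological ring, and let $X$ be a set. If $X$ is infinite, then the topological ring $(R,\tau)^X$ is not rigid.
   Context: Rings are commutative and unital; topologies are Hausdorff. A topological ring is a ring with a topology making addition, negation and multiplication (jointly) continuous. The topological ring $(R,\tau)^X$ is the ring $R^X$ of all maps $X\to R$ with pointwise operations and the product topology. For a topological ring $(S,\sigma)$ and a set $Y$, $(S,\sigma)^Y$ is also regarded as a topological $S$-module, $S^{(Y)}$ is the $S$-module of finitely supported maps $Y\to S$, and $((S,\sigma)^Y)'$ is the $S$-module of continuous $S$-linear maps $(S,\sigma)^Y\to(S,\sigma)$. $(S,\sigma)$ is rigid if for every set $Y$ the $S$-linear map $\lambda_Y\colon S^{(Y)}\to((S,\sigma)^Y)'$, $\lambda_Y(p)(f)=\sum_{y\in Y}p(y)f(y)$, is an isomorphism.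
   Formalization: The ring R is assumed nonzero (1 ≠ 0): if R is the zero ring, then R^X is the zero ring, for which every λ_Y is an isomorphism of one-point modules, so R^X is rigid and the claim fails. *)

(* Defs.v *)
From HB Require Import structures.
From mathcomp Require Import all_boot all_order all_algebra.
From mathcomp Require Import all_classical topology tvs.

Set Implicit Arguments.
Unset Strict Implicit.
Unset Printing Implicit Defensive.

Import GRing.Theory.
Local Open Scope classical_set_scope.
Local Open Scope ring_scope.

(** Commutative unital Hausdorff topological rings. The algebraic base is
    [comPzRingType]: the zero ring is allowed. *)
HB.mixin Record TopologicalZmodule_isHausdorffTopologicalRing R
    & TopologicalZmodule R & GRing.ComPzRing R := {
  ring_mul_continuous : continuous (fun x : R * R => x.1 * x.2) ;
  ring_hausdorff : hausdorff_space R
}.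

#[short(type="topComRingType")]
HB.structure Definition TopologicalComRing :=
  {R of TopologicalZmodule R & GRing.ComPzRing R
      & TopologicalZmodule_isHausdorffTopologicalRing R}.

(** [power X R] is the set [R^X] of all maps from [X] to [R]. It is an alias
    of [X -> R], so that the pointwise operations and the product topology are
    canonical on it without putting a topology on every function type. *)
Definition power (X R : Type) : Type := X -> R.

Section PowerRing.
Variables (X : Type) (R : topComRingType).

HB.instance Definition _ := GRing.ComPzRing.copy (power X R) (X -> R).
HB.instance Definition _ := Topological.copy (power X R) {ptws X -> R}.

Lemma power_eval_continuous (x : X) : continuous (fun f : power X R => f x).
Proof.
exact: (@proj_continuous {classic X} (fun=> R) x).
Qed.

Lemma cvg_powerP (T : Type) (F : set_system T) (u : T -> power X R)
    (f : power X R) : Filter F ->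
  (forall x, u t x @[t --> F] --> f x) -> u @ F --> f.
Proof.
move=> FF uf; apply/cvg_sup => x.
apply/cvg_image; first by rewrite eqEsubset; split => y //; exists (cst y).
move=> A Af; have := uf x A Af; rewrite /nbhs /= => uA.
exists ((fun g : X -> R => g x) @^-1` A) => //.
by apply/seteqP; split=> [y [g gA <-]//|y Ay]; exists (cst y).
Qed.

Let fst_eval_continuous (x : X) :
  continuous (fun z : power X R * power X R => z.1 x).
Proof.
move=> z; apply: (@continuous_comp _ _ _ fst (fun f : power X R => f x)).
  exact: cvg_fst.
exact: power_eval_continuous.
Qed.

Let snd_eval_continuous (x : X) :
  continuous (fun z : power X R * power X R => z.2 x).
Proof.
move=> z; apply: (@continuous_comp _ _ _ snd (fun f : power X R => f x)).
  exact: cvg_snd.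
exact: power_eval_continuous.
Qed.

Let power_add_continuous :
  continuous (fun z : power X R * power X R => z.1 + z.2).
Proof.
move=> z; apply: (@cvg_powerP _ (nbhs z)) => x.
apply: (@continuous_comp _ _ _
  (fun z : power X R * power X R => (z.1 x, z.2 x)) (fun r : R * R => r.1 + r.2)).
  apply: cvg_pair; [exact: fst_eval_continuous|exact: snd_eval_continuous].
exact: add_continuous.
Qed.

Let power_mul_continuous :
  continuous (fun z : power X R * power X R => z.1 * z.2).
Proof.
move=> z; apply: (@cvg_powerP _ (nbhs z)) => x.
apply: (@continuous_comp _ _ _
  (fun z : power X R * power X R => (z.1 x, z.2 x)) (fun r : R * R => r.1 * r.2)).
  apply: cvg_pair; [exact: fst_eval_continuous|exact: snd_eval_continuous].
exact: ring_mul_continuous.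
Qed.

Let power_opp_continuous : continuous (-%R : power X R -> power X R).
Proof.
move=> z; apply: (@cvg_powerP _ (nbhs z)) => x.
apply: (@continuous_comp _ _ _ (fun z : power X R => z x) (-%R : R -> R)).
  exact: power_eval_continuous.
exact: opp_continuous.
Qed.

Let power_hausdorff : hausdorff_space (power X R).
Proof.
exact: (@hausdorff_product {classic X} (fun=> R) (fun=> @ring_hausdorff R)).
Qed.

HB.instance Definition _ :=
  PreTopologicalNmodule_isTopologicalNmodule.Build (power X R)
    power_add_continuous.
HB.instance Definition _ :=
  TopologicalNmodule_isTopologicalZmodule.Build (power X R)
    power_opp_continuous.
HB.instance Definition _ :=
  TopologicalZmodule_isHausdorffTopologicalRing.Build (power X R)
    power_mul_continuous power_hausdorff.

End PowerRing.

Section Rigidity.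
Variable S : topComRingType.

HB.instance Definition _ (Y : Type) :=
  GRing.Lmodule.copy (power Y S) (Y -> S^o).

Variable Y : Type.

Definition fin_supp : {pred Y -> S^o} :=
  fun p => `[< finite_set [set y | p y != 0] >].

Lemma fin_supp_submod_closed : submod_closed fin_supp.
Proof.
split.
  apply/asboolP; apply: sub_finite_set (@finite_set0 Y) => y /=.
  by rewrite eqxx.
move=> a p q /asboolP fp /asboolP fq; apply/asboolP.
have : finite_set ([set y | p y != 0] `|` [set y | q y != 0]) by rewrite finite_setU.
apply: sub_finite_set => y /= pq0.
have [p0|] := eqVneq (p y) 0; last by left.
right; apply: contra_neq pq0 => q0.
by rewrite [LHS](_ : _ = a *: p y + q y)// p0 q0 scaler0 addr0.
Qed.

HB.instance Definition _ :=
  GRing.isSubmodClosed.Build S (Y -> S^o) fin_supp fin_supp_submod_closed.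

(** The [S]-module [S^(Y)] of finitely supported maps, as a submodule of
    [Y -> S^o]. *)
Record fsmod := FSMod {
  fsmod_val :> Y -> S^o ; fsmod_valP : fsmod_val \in fin_supp }.

HB.instance Definition _ := [isSub for fsmod_val].
HB.instance Definition _ := [Choice of fsmod by <:].
HB.instance Definition _ := [SubChoice_isSubLmodule of fsmod by <:].

Definition cont_linear : {pred power Y S -> S^o} :=
  fun F => `[< scalar (F : power Y S -> S) /\
               continuous (F : power Y S -> S) >].

Let continuous_comp2 (T : topologicalType) (u v : T -> S) (op : S * S -> S) :
  continuous op -> continuous u -> continuous v ->
  continuous (fun t => op (u t, v t)).
Proof.
move=> cop cu cv t; apply: (@continuous_comp _ _ _ (fun t => (u t, v t)) op).
  by apply: cvg_pair; [exact: cu|exact: cv].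
exact: cop.
Qed.

Lemma cont_linear_submod_closed : submod_closed cont_linear.
Proof.
split.
  apply/asboolP; split; first by move=> a f g /=; rewrite mulr0 addr0.
  exact: cst_continuous.
move=> a F G /asboolP[lF cF] /asboolP[lG cG]; apply/asboolP; split.
  move=> b f g.
  rewrite [LHS](_ : _ = a * F (b *: f + g) + G (b *: f + g))//.
  rewrite [RHS](_ : _ = b * (a * F f + G f) + (a * F g + G g))// lF lG.
  by rewrite !mulrDr !mulrA (mulrC a b) addrACA.
apply: (@continuous_comp2 _ (fun f : power Y S => a * F f) G
  (fun r : S * S => r.1 + r.2)) => //; first exact: add_continuous.
apply: (@continuous_comp2 _ (fun=> a) F (fun r : S * S => r.1 * r.2)) => //.
  exact: ring_mul_continuous.
exact: cst_continuous.
Qed.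

HB.instance Definition _ :=
  GRing.isSubmodClosed.Build S (power Y S -> S^o) cont_linear
    cont_linear_submod_closed.

(** The [S]-module [(S^Y)'], with the pointwise operations. *)
Record cdual := CDual {
  cdual_val :> power Y S -> S^o ; cdual_valP : cdual_val \in cont_linear }.

HB.instance Definition _ := [isSub for cdual_val].
HB.instance Definition _ := [Choice of cdual by <:].
HB.instance Definition _ := [SubChoice_isSubLmodule of cdual by <:].

(** The sum is over the (finite) support of [y |-> p y * f y]; [{classic Y}]
    only provides the [choiceType] structure required by [\sum_(_ \in _)]. *)
Definition pairing (p : fsmod) : power Y S -> S^o :=
  fun f => \sum_(y \in [set: {classic Y}]) p y * f y.

Lemma pairingE (p : fsmod) (r : seq {classic Y}) f : uniq r ->
  (forall y : {classic Y}, p y != 0 -> y \in r) -> pairing p f = \sum_(y <- r) p y * f y.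
Proof.
move=> ur pr; rewrite /pairing (fsbigE r)//.
  by apply: eq_bigl => y; rewrite in_setT.
move=> y _ yr; have [->|/pr] := eqVneq (p y) 0; first by rewrite mul0r.
by rewrite (negPf yr).
Qed.

Lemma fsmod_seq (p : fsmod) :
  exists2 r : seq {classic Y}, uniq r & forall y : {classic Y}, p y != 0 -> y \in r.
Proof.
have /asboolP/(@finite_seqP {classic Y})[r rE] := fsmod_valP p.
exists (undup r); first exact: undup_uniq.
move=> y py; rewrite mem_undup.
by have : [set` r] y by rewrite -rE.
Qed.

Lemma pairing_cont_linear (p : fsmod) : pairing p \in cont_linear.
Proof.
have [r ur pr] := fsmod_seq p; apply/asboolP.
have -> : pairing p = fun f => \sum_(y <- r) p y * f y.
  by apply/funext => f; exact: pairingE.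
split.
  move=> a f g; rewrite mulr_sumr -big_split/=; apply: eq_bigr => y _.
  rewrite [(_ + _) y](_ : _ = a * f y + g y)//.
  by rewrite mulrDr mulrCA.
elim: r {ur pr} => [|y r ih].
  by under eq_fun do rewrite big_nil; exact: cst_continuous.
under eq_fun do rewrite big_cons.
apply: (@continuous_comp2 _ (fun f : power Y S => p y * f y) _
  (fun r : S * S => r.1 + r.2)) => //; first exact: add_continuous.
apply: (@continuous_comp2 _ (fun=> p y) (fun f : power Y S => f y)
  (fun r : S * S => r.1 * r.2)).
- exact: ring_mul_continuous.
- exact: cst_continuous.
- exact: power_eval_continuous.
Qed.

Definition lambda (p : fsmod) : cdual := CDual (pairing_cont_linear p).

Lemma lambda_linear : linear lambda.
Proof.
move=> a p q; apply/val_inj/funext => f.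
have [r ur pr] := fsmod_seq p; have [s us qs] := fsmod_seq q.
pose t := undup (r ++ s).
have pt (y : {classic Y}) : p y != 0 -> y \in t by move=> /pr; rewrite mem_undup mem_cat => ->.
have qt (y : {classic Y}) : q y != 0 -> y \in t.
  by move=> /qs; rewrite mem_undup mem_cat orbC => ->.
rewrite [RHS](_ : _ = a * pairing p f + pairing q f)//.
rewrite (_ : val _ = pairing (a *: p + q))//.
have ut : uniq t by exact: undup_uniq.
have E y : (a *: p + q : fsmod) y = a * p y + q y by [].
rewrite !(@pairingE _ t)//; last first.
  move=> y; rewrite E; have [->|/pt//] := eqVneq (p y) 0.
  by rewrite mulr0 add0r => /qt.
rewrite mulr_sumr -big_split/=; apply: eq_bigr => y _.
by rewrite -[LHS]/((a * p y + q y) * f y) mulrDl mulrA.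
Qed.

HB.instance Definition _ :=
  GRing.isLinear.Build S fsmod cdual *:%R lambda lambda_linear.

End Rigidity.

(** [lambda] is canonically linear, so it is an isomorphism of [S]-modules iff
    it is bijective. *)
Definition rigid (S : topComRingType) : Prop :=
  forall Y : Type, bijective (@lambda S Y).

Lemma rigid_zero_ring (S : topComRingType) : (1 : S) = 0 -> rigid S.
Proof.
move=> S0; have eqS (x y : S) : x = y by rewrite -(mulr1 x) -(mulr1 y) S0 !mulr0.
by move=> Y; exists (fun=> 0) => F; apply/val_inj/funext => y; exact: eqS.
Qed.

(* Main.v *)
(** For [S = R^X] and [Y = X], the diagonal functional [f |-> (x |-> f x x)] on
    [S^X] is continuous and [S]-linear. It sends the [y]-th unit vector to the
    [y]-th idempotent of [R^X], which is nonzero, so if it were [lambda p] then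
    [p] would have all of [X] as its support. *)
Require Import Defs.
From mathcomp Require Import all_boot all_order all_algebra.
From mathcomp Require Import all_classical topology tvs.

Import GRing.Theory.
Local Open Scope classical_set_scope.
Local Open Scope ring_scope.

Definition diagonal (R : topComRingType) (X : Type) :
    power X (power X R) -> (power X R)^o :=
  fun f x => f x x.

(** A scalar [a] multiplies the entry [f x x] by [a x], so linearity holds by computation.
    Continuity is checked coordinatewise: each coordinate is a composite of two evaluations at
    [x]. *)
Lemma diagonal_cont_linear (R : topComRingType) (X : Type) :
  diagonal R X \in @cont_linear (power X R) X.
Proof.
apply/asboolP; split => // f.
apply: (@cvg_powerP _ _ _ (nbhs f)) => x.
apply: (@continuous_comp _ _ _ (fun g : power X (power X R) => g x)
  (fun h : power X R => h x)); exact: power_eval_continuous.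
Qed.

Definition unit_vector (S : topComRingType) (Y : Type) (y : {classic Y}) :
    power Y S :=
  fun z : {classic Y} => if z == y then 1 else 0.

Lemma pairing_unit_vector_eq0 (S : topComRingType) (Y : Type) (p : fsmod S Y)
    (y : {classic Y}) : p y = 0 -> pairing p (unit_vector S Y y) = 0.
Proof.
move=> py0; apply: fsbig1 => z _; rewrite /unit_vector.
by case: eqVneq => [->|_]; rewrite ?py0 ?mul0r ?mulr0.
Qed.

(* Rings are taken to be nonzero: if 1 = 0 in R then R^X is the zero ring,
   which is rigid. *)
Theorem proposition25 (R : topComRingType) (R_nonzero : (1 : R) != 0) (X : Type) :
  infinite_set [set: X] -> ~ rigid (power X R).
Proof.
move=> Xinf /(_ X)[mu _ muK]; apply: Xinf.
pose F := CDual (diagonal_cont_linear R X).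
have /asboolP := fsmod_valP (mu F).
(* The finite support of [mu F] contains every [y]: a zero there would force [1 = 0] in [R]. *)
apply: sub_finite_set => y _ /=; apply: contra_neq R_nonzero => py0.
have pF : pairing (mu F) = diagonal R X := congr1 (@cdual_val _ _) (muK F).
have := pairing_unit_vector_eq0 _ _ _ _ py0; rewrite pF.
(* At coordinate [y], the diagonal of the [y]-th unit vector is [1]. *)
by move=> /(congr1 (fun h : power X R => h y)); rewrite /diagonal /unit_vector eqxx.
Qed.
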